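(* Let $K\ge2$ be an integer, $\alpha\in(0,1)$, $c_1,\dots,c_K\in\mathbb{R}$, $\beta>0$, and let $\varphi_1^{\mathrm{in}},\dots,\varphi_K^{\mathrm{in}}\in C^{1,\alpha}(\mathbb{T}^2)$ be real-valued functions such that the sets $\Omega_k=\{x\in\mathbb{T}^2:\varphi_k^{\mathrm{in}}(x)>\varphi_j^{\mathrm{in}}(x)\ \text{for all }j\ne k\}$, $k=1,\dots,K$, cover $\mathbb{T}^2$ up to a set of measure zero. Let $\omega^\beta$ be the regularized Euler vorticity, $\omega(t,x)=\sum_{k=1}^K c_k\mathbf{1}_{\Omega_k(t)}(x)$ the sharp multi-phase Euler vorticity, and $\varphi_k^\beta$, $\varphi_k$ the corresponding transported markers (as defined in the context). Fix $t\ge0$ and $\delta>0$, and set $$E_\beta(t)=\max_{1\le k\le K}\|\varphi_k^\beta(t,\cdot)-\varphi_k(t,\cdot)\|_{L^\infty(\mathbb{T}^2)}.$$ Then $$\sup_{\mathrm{dist}(x,\Gamma(t))\ge\delta}\bigl|\omega^\beta(t,x)-\omega(t,x)\bigr|\le(K-1)\max_{1\le i,j\le K}|c_i-c_j|\;e^{-\beta\,(c_\delta(t)-2E_\beta(t))},$$ where $\Gamma(t)=\bigcup_{1\le i<j\le K}\{x\in\mathbb{T}^2:\varphi_i(t,x)=\varphi_j(t,x)\}$ is the global tie set and $c_\delta(t)$ is the $\delta$-gap at time $t$ defined in the context.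
   Context: The Euler equation in vorticity form on the flat torus $\mathbb{T}^2$ is $\partial_t\omega+u\cdot\nabla\omega=0$, $u=\nabla^\perp\psi$, $-\Delta\psi=\omega-\langle\omega\rangle$, where $\langle\omega\rangle$ is the spatial mean and $\nabla^\perp=(\partial_2,-\partial_1)$. For bounded initial vorticity there is a unique global bounded-vorticity (Yudovich) solution; its velocity generates a unique flow map of homeomorphisms of $\mathbb{T}^2$. Let $\omega$ be the Yudovich solution, with velocity $u$ and flow map $X$, with initial vorticity $\omega_0=\sum_{k=1}^K c_k\mathbf{1}_{\Omega_k}$; let $\omega^\beta$ be the one, with velocity $u^\beta$ and flow map $X^\beta$, with initial vorticity $\omega_0^\beta=\sum_{k=1}^K c_k\,e^{\beta\varphi_k^{\mathrm{in}}}/\sum_{j=1}^K e^{\beta\varphi_j^{\mathrm{in}}}$ ($\omega^\beta$ is taken as its continuous representative). The transported markers solve $\partial_t\varphi_k+u\cdot\nabla\varphi_k=0$ and $\partial_t\varphi_k^\beta+u^\beta\cdot\nabla\varphi_k^\beta=0$ with initial data $\varphi_k^{\mathrm{in}}$, i.e. $\varphi_k(t,x)=\varphi_k^{\mathrm{in}}(X(t,\cdot)^{-1}(x))$ and $\varphi_k^\beta(t,x)=\varphi_k^{\mathrm{in}}(X^\beta(t,\cdot)^{-1}(x))$. The transported phases are $\Omega_k(t)=X(t,\Omega_k)=\{x:\varphi_k(t,x)>\varphi_j(t,x)\ \text{for all }j\ne k\}$, and $\omega(t,\cdot)$ is taken pointwise to be the representative $\sum_k c_k\mathbf{1}_{\Omega_k(t)}$.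 For $x\in\mathbb{T}^2$ let $k(t,x)\in\arg\max_{1\le\ell\le K}\varphi_\ell(t,x)$ and define the winner-phase gap $$\Delta(t,x)=\varphi_{k(t,x)}(t,x)-\max_{j\ne k(t,x)}\varphi_j(t,x)\ge0.$$ The $\delta$-gap at time $t$ is $$c_\delta(t)=\inf_{\{x:\ \mathrm{dist}(x,\Gamma(t))\ge\delta\}}\Delta(t,x).$$ Conventions: $\mathrm{dist}(x,\emptyset)=+\infty$; the infimum over the empty set is $+\infty$ and the supremum over the empty set is $0$. *)

(* Defs.v *)
From HB Require Import structures.
From mathcomp Require Import all_boot all_order all_algebra.
From mathcomp Require Import all_classical all_reals all_analysis.
Set Implicit Arguments.
Unset Strict Implicit.
Unset Printing Implicit Defensive.
Import Order.TTheory GRing.Theory Num.Theory.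
Import numFieldNormedType.Exports.
Local Open Scope classical_set_scope.
Local Open Scope ring_scope.

(* The flat torus is T^2 = R^2 / Z^2 (total area 1).  Functions on T^2 are
   Z^2-periodic functions on R^2, and self-homeomorphisms of T^2 isotopic to
   the identity are homeomorphisms of R^2 commuting with the translations by
   Z^2.  Negligible sets, L^oo norms, Hoelder moduli and distances to
   Z^2-invariant sets are then the same on R^2 as on T^2. *)

Notation area R := (@lebesgue_measure R \x @lebesgue_measure R)%E.

Section Torus.
Variable R : realType.
Implicit Types (f g : R * R -> R) (x y : R * R).

Definition translate x (m n : int) : R * R := (x.1 + m%:~R, x.2 + n%:~R).

Definition torus_periodic f : Prop :=
  forall x (m n : int), f (translate x m n) = f x.

Definition torus_int f : R :=
  \int[area R]_(x in `[0, 1] `*` `[0, 1]) f x.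

Definition euclid_dist x y : R :=
  Num.sqrt ((x.1 - y.1) ^+ 2 + (x.2 - y.2) ^+ 2).

(* Equals +oo when A is empty. *)
Definition dist_set x (A : set (R * R)) : \bar R :=
  ereal_inf [set (euclid_dist x y)%:E | y in A].

Definition partial1 f x : R := 'D_(1, 0) f x.
Definition partial2 f x : R := 'D_(0, 1) f x.

Definition torus_C1 f : Prop :=
  [/\ torus_periodic f, (forall x, differentiable f x),
      continuous (partial1 f) & continuous (partial2 f)].

Definition torus_C1alpha (a : R) f : Prop :=
  torus_C1 f /\
  exists C : R, forall x y,
    `|partial1 f x - partial1 f y| <= C * euclid_dist x y `^ a /\
    `|partial2 f x - partial2 f y| <= C * euclid_dist x y `^ a.

Definition perp_grad f x : R * R := (partial2 f x, - partial1 f x).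

End Torus.

Section Euler.
Variable R : realType.
Implicit Types (w : R -> R * R -> R).
Implicit Types (u X : R -> R * R -> R * R).

(* - Laplacian psi = w - <w>, tested against C^1 functions. *)
Definition weak_poisson (psi w0 : R * R -> R) : Prop :=
  forall phi : R * R -> R, torus_C1 phi ->
    torus_int (fun x => partial1 psi x * partial1 phi x +
                        partial2 psi x * partial2 phi x) =
    torus_int (fun x => (w0 x - torus_int w0) * phi x).

Definition velocity_of (v : R * R -> R * R) (w0 : R * R -> R) : Prop :=
  exists psi : R * R -> R,
    [/\ torus_C1 psi, weak_poisson psi w0 & v = perp_grad psi].

(* The distributional form of d_t w + u . grad w = 0, w(0) = w0, for the
   divergence-free field u, integrated in time. *)
Definition weak_vorticity_eq (w0 : R * R -> R) w u : Prop :=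
  forall phi : R * R -> R, torus_C1 phi -> forall t : R, 0 <= t ->
    torus_int (fun x => w t x * phi x) - torus_int (fun x => w0 x * phi x) =
    \int[@lebesgue_measure R]_(s in `[0, t])
      torus_int (fun x => w s x * ((u s x).1 * partial1 phi x +
                                   (u s x).2 * partial2 phi x)).

Definition homeomorphism (f : R * R -> R * R) : Prop :=
  exists g, [/\ continuous f, continuous g, cancel f g & cancel g f].

Record flow_map u X : Prop := {
  flow_init : forall x, X 0 x = x ;
  flow_translate : forall t x (m n : int), 0 <= t ->
    X t (translate x m n) = translate (X t x) m n ;
  flow_homeo : forall t, 0 <= t -> homeomorphism (X t) ;
  flow_continuous : forall x,
    {within `[0, +oo[, continuous (fun t : R => X t x)} ;
  flow_ode : forall (t : R) x, 0 < t ->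
    is_derive t 1 (fun s : R => X s x) (u t (X t x)) }.

(* The solution of d_t f + u . grad f = 0, f(0) = f0, along the flow X of u. *)
Definition transport X (f0 : R * R -> R) (t : R) (x : R * R) : R :=
  f0 (pinv setT (X t) x).

(* Global bounded-vorticity solution with velocity u and flow X.  As u is only
   log-Lipschitz in x, the vorticity equation holds in the sense of
   distributions and along the flow, rather than classically. *)
Record yudovich_solution (w0 : R * R -> R) w u X : Prop := {
  yudovich_measurable : forall t, 0 <= t -> measurable_fun setT (w t) ;
  yudovich_periodic : forall t, 0 <= t -> torus_periodic (w t) ;
  yudovich_bounded : exists M : R, forall t x, 0 <= t -> `|w t x| <= M ;
  yudovich_velocity : forall t, 0 <= t -> velocity_of (u t) (w t) ;
  yudovich_weak : weak_vorticity_eq w0 w u ;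
  yudovich_flow : flow_map u X ;
  yudovich_transport : forall t, 0 <= t ->
    {ae area R, forall x, w t x = transport X w0 t x} }.

End Euler.

Section Phases.
Variables (R : realType) (K : nat).
Implicit Types (c : 'I_K -> R) (phi : 'I_K -> R * R -> R).

Definition phase phi (k : 'I_K) : set (R * R) :=
  [set x | forall j, j != k -> phi j x < phi k x].

Definition sharp_vorticity c (Omega : 'I_K -> set (R * R)) x : R :=
  \sum_(k < K) c k * \1_(Omega k) x.

Definition softmax_vorticity c (beta : R) phi x : R :=
  (\sum_(k < K) c k * expR (beta * phi k x)) /
  \sum_(j < K) expR (beta * phi j x).

Definition tie_set phi : set (R * R) :=
  [set x | exists i j : 'I_K, (i < j)%N /\ phi i x = phi j x].

Definition max_jump c : R :=
  \big[Num.max/0]_(i < K) \big[Num.max/0]_(j < K) `|c i - c j|.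

Definition is_winner phi (k : R * R -> 'I_K) : Prop :=
  forall x l, phi l x <= phi (k x) x.

Local Open Scope ereal_scope.

Definition winner_gap phi (k : R * R -> 'I_K) x : \bar R :=
  (phi (k x) x)%:E - \big[maxe/-oo]_(j < K | j != k x) (phi j x)%:E.

Definition far_from (delta : R) (A : set (R * R)) : set (R * R) :=
  [set x | delta%:E <= dist_set x A].

Definition delta_gap phi (k : R * R -> 'I_K) (delta : R) : \bar R :=
  ereal_inf [set winner_gap phi k x | x in far_from delta (tie_set phi)].

Definition marker_error (phi psi : 'I_K -> R * R -> R) : \bar R :=
  \big[maxe/-oo]_(k < K)
    'N[area R]_+oo[EFin \o (phi k - psi k)%R].

(* Adjoining 0 to a set of nonnegative values makes the supremum over the
   empty set 0 and changes nothing otherwise. *)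
Definition sup_on (A : set (R * R)) (f : R * R -> R) : \bar R :=
  ereal_sup ([set `|(f x)%:E| | x in A] `|` [set 0]).

End Phases.

(* Main.v *)
(** Off the tie set the sharp vorticity at x is c_k with k the winner, while the
    regularized one is the average of the c_j with weights proportional
    to exp(beta phib_j).  The weight of a loser j is at most exp(-beta (phib_k - phib_j)),
    and replacing phib by phi costs at most 2 E in the exponent.  The almost
    everywhere identities and bounds hold at every point because both sides
    are continuous and nonempty open sets have positive area. *)

Require Import Defs.
From HB Require Import structures.
From mathcomp Require Import all_boot all_order all_algebra.
From mathcomp Require Import all_classical all_reals all_analysis.
From mathcomp Require Import ess_sup_inf lra.
Set Implicit Arguments.
Unset Strict Implicit.
Unset Printing Implicit Defensive.
Import Order.TTheory GRing.Theory Num.Theory.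
Import numFieldNormedType.Exports.
Local Open Scope classical_set_scope.
Local Open Scope ring_scope.

(** A point of [O] is the centre of a product of two balls of radius [e] inside [O], and this square
    has area (2e)^2 > 0, too much for a null cover [A]. *)
Lemma open_negligible_area (R : realType) (O : set (R * R)) :
  open O -> (area R).-negligible O -> O = set0.
Proof.
move=> Oo [A [mA A0 OA]]; apply/seteqP; split=> // x Ox.
have /nbhs_ballP[e /= e0 eO] : nbhs x O by exact: open_nbhs_nbhs.
have mb (y : R) : measurable (ball y e) by rewrite ball_itv; exact: measurable_itv.
have : ((area R) (ball x.1 e `*` ball x.2 e) <= (area R) A)%E.
  apply: le_measure; rewrite ?inE//; first by apply: measurableX; exact: mb.
  by move=> y [y1 y2]; apply/OA/eO; split.
have := @product_measure1E _ _ _ _ R (@lebesgue_measure R)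
  (@lebesgue_measure R) _ _ (mb x.1) (mb x.2).
rewrite /= => ->; rewrite A0 !lebesgue_measure_ball ?(ltW e0)//.
by rewrite -EFinM lee_fin leNgt mulr_gt0// pmulrn_lgt0.
Qed.

Lemma ae_closed (R : realType) (P : set (R * R)) :
  closed P -> {ae area R, forall x, P x} -> forall x, P x.
Proof.
move=> Pc nP x; apply: contrapT => nPx.
have CP0 : ~` P = set0.
  by apply: open_negligible_area => //; exact: closed_openC.
by have : (~` P) x by []; rewrite CP0.
Qed.

Lemma ae_eq_continuous (R : realType) (f g : R * R -> R) :
  continuous f -> continuous g ->
  {ae area R, forall x, f x = g x} -> forall x, f x = g x.
Proof.
move=> fc gc fg x; apply/eqP; rewrite -subr_eq0; apply/eqP.
move: x; apply: (@ae_closed _ [set x | f x - g x = 0]).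
  apply: (@preimage_closed _ _ (fun x => f x - g x) [set 0]).
    by move=> x _; apply: cvgB; [exact: fc|exact: gc].
  exact: closed_eq.
by apply: negligibleS fg => x; apply: contra_not => /= ->; rewrite subrr.
Qed.

Lemma le_Lnormy_continuous (R : realType) (f : R * R -> R) :
  continuous f ->
  forall x, (`|(f x)%:E| <= 'N[area R]_+oo[EFin \o f])%E.
Proof.
move=> fc; rewrite unlock; case: ifPn => [_|a0].
  apply: (@ae_closed _ [set x | (`|(f x)%:E| <= _)%E]).
    apply: (@preimage_closed _ _ (fun x => `|(f x)%:E|%E) [set y | (y <= _)%E]).
      move=> x _; apply: cvg_EFin; first exact: nearW.
      by apply: cvg_norm; exact: fc.
    exact: closed_ereal_ge_ereal.
  exact: ess_sup_ge.
(* By convention the L^oo norm is 0 when the whole space has measure zero. That branch is excluded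
   here: the whole plane would be a negligible open set, hence empty. *)
suff /seteqP[/(_ (0, 0))/=] : [set: R * R] = set0 by case.
apply: open_negligible_area; first exact: openT.
exists setT; split => //; apply/eqP.
by rewrite eq_le measure_ge0 andbT leNgt.
Qed.

(** [transport] is written with the choice-based [pinv]; injectivity forces it to coincide with the
    continuous inverse [g]. *)
Lemma homeomorphism_pinv (R : realType) (f : R * R -> R * R) :
  homeomorphism f ->
  [/\ continuous (pinv setT f), cancel f (pinv setT f)
    & cancel (pinv setT f) f].
Proof.
move=> [g [_ gc fg gf]].
have fK : cancel f (pinv setT f).
  by move=> x; rewrite pinvKV ?inE// => ? ? _ _; exact: (can_inj fg).
have <- : g = pinv setT f by apply/funext => x; rewrite -{2}(gf x) fK.
by split.
Qed.

Lemma transport_continuous (R : realType) (X : R -> R * R -> R * R)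
    (f : R * R -> R) (t : R) :
  homeomorphism (X t) -> continuous f -> continuous (transport X f t).
Proof.
move=> /homeomorphism_pinv[gc _ _] fc x.
by apply: continuous_comp; [exact: gc|exact: fc].
Qed.

(** The sharp vorticity is built on the moved sets, the tie set and the gap on the moved markers;
    bijectivity of [X t] reconciles the two descriptions. *)
Lemma image_phase (R : realType) (K : nat) (X : R -> R * R -> R * R)
    (phi : 'I_K -> R * R -> R) (t : R) (k : 'I_K) :
  homeomorphism (X t) ->
  X t @` phase phi k = phase (fun j => transport X (phi j) t) k.
Proof.
move=> /homeomorphism_pinv[_ fK gK]; apply/seteqP; split=> [_ [y yk <-] j jk|x xk].
  by rewrite /transport fK; exact: yk.
by exists (pinv setT (X t) x); [exact: xk|exact: gK].
Qed.

Section Phases.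
Variables (R : realType) (K : nat).
Implicit Types (c : 'I_K -> R) (phi : 'I_K -> R * R -> R).

Lemma sharp_vorticityE c phi (k : 'I_K) x :
  phase phi k x -> sharp_vorticity c (phase phi) x = c k.
Proof.
move=> xk; rewrite /sharp_vorticity (bigD1 k)//= big1 => [|j jk].
  by rewrite addr0 indicE mem_set// mulr1.
rewrite indicE memNset ?mulr0// => xj.
by have := lt_trans (xk _ jk) (xj k _); rewrite eq_sym jk ltxx => /(_ isT).
Qed.

(** If another index tied with the winner, [x] itself would lie in the tie set, at distance 0 <
    [delta]. *)
Lemma far_phase phi (winner : R * R -> 'I_K) delta x :
  0 < delta -> is_winner phi winner ->
  far_from delta (tie_set phi) x -> phase phi (winner x) x.
Proof.
move=> d0 win; rewrite /far_from/= => far j jk.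
rewrite lt_neqAle win andbT; apply/negP => /eqP phijk.
suff xtie : tie_set phi x.
  have : (dist_set x (tie_set phi) <= 0)%E.
    apply: ereal_inf_lbound; exists x => //.
    by rewrite /euclid_dist !subrr expr0n addr0 sqrtr0.
  by move=> /(le_trans far); rewrite lee_fin leNgt d0.
have /orP[jk'|kj] : (j < winner x)%N || (winner x < j)%N by rewrite -neq_ltn.
- by exists j, (winner x).
- by exists (winner x), j.
Qed.

Lemma max_jump_ge c i j : `|c i - c j| <= max_jump c.
Proof.
by apply: le_trans (le_bigmax _ _ i); exact: (le_bigmax _ (fun j => `|c i - c j|)).
Qed.

Lemma softmax_continuous c beta phi :
  (forall k, continuous (phi k)) -> continuous (softmax_vorticity c beta phi).
Proof.
move=> phic.
have ec k : continuous (fun x => expR (beta * phi k x)).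
  move=> x; apply: continuous_comp; last exact: continuous_expR.
  by apply: cvgM; [exact: cvg_cst|exact: phic].
(* With no phases the quotient is 0 / 0, which is the constant 0. Otherwise a single exponential
   already makes the denominator positive. *)
move=> x; have [K0|K0] := posnP K.
  rewrite /softmax_vorticity; subst K.
  under eq_fun do rewrite !big_ord0.
  exact: cvg_cst.
apply: cvgM; last apply: cvgV.
- apply: (@continuous_big _ _ _ _ _ add_continuous _ _
    (fun k x => c k * expR (beta * phi k x))) => k _ y.
  by apply: cvgM; [exact: cvg_cst|exact: ec].
- rewrite gt_eqF// (bigD1 (Ordinal K0))//= ltr_pwDl ?expR_gt0//.
  by apply: sumr_ge0 => j _; exact: expR_ge0.
- apply: (@continuous_big _ _ _ _ _ add_continuous _ _
    (fun k x => expR (beta * phi k x))) => k _ y.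
  exact: ec.
Qed.

(** Write c_k as c_k S / S with S the sum of the exponentials. The k-th terms cancel, and every
    other weight is at most exp(beta phi_j) / exp(beta phi_k), since S dominates its k-th term. *)
Lemma softmax_error c beta phi (k : 'I_K) x :
  `|softmax_vorticity c beta phi x - c k| <=
  max_jump c * \sum_(j < K | j != k) expR (- (beta * (phi k x - phi j x))).
Proof.
rewrite /softmax_vorticity; set S := (X in _ / X).
have kS : expR (beta * phi k x) <= S.
  by rewrite /S (bigD1 k)//= lerDl sumr_ge0// => j _; exact: expR_ge0.
have S0 : 0 < S by rewrite (lt_le_trans _ kS)// expR_gt0.
rewrite -[c k](mulfK (lt0r_neq0 S0)) -mulrBl normrM normfV (gtr0_norm S0).
rewrite mulr_sumr -sumrB (bigD1 k)//= subrr add0r.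
rewrite ler_pdivrMr// [max_jump c * _]mulr_sumr mulr_suml.
apply: le_trans (ler_norm_sum _ _ _) _; apply: ler_sum => j jk.
rewrite -mulrBl normrM (gtr0_norm (expR_gt0 _)) -mulrA.
apply: ler_pM => //; first exact: max_jump_ge.
apply: le_trans (ler_wpM2l (expR_ge0 _) kS).
by rewrite -expRD mulrBr opprB subrK.
Qed.

(* An extended real D covers an infinite marker error, where the gap minus
   twice the error is -oo and the right-hand side is +oo (0 if c is constant). *)
Lemma softmax_error_ereal c beta phi (k : 'I_K) x (D : \bar R) :
  (2 <= K)%N -> 0 < beta ->
  (forall j, j != k -> (D <= (phi k x - phi j x)%:E)%E) ->
  (`|(softmax_vorticity c beta phi x - c k)%:E| <=
   ((K%:R - 1) * max_jump c)%:E * expeR (- (beta%:E * D)))%E.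
Proof.
move=> K2 beta0 HD.
have J0 : 0 <= max_jump c by apply: le_trans (max_jump_ge c k k).
have K10 : 0 < K%:R - 1 :> R by rewrite subr_gt0 ltr1n.
have cardK : #|[pred j : 'I_K | j != k]|%:R = K%:R - 1 :> R.
  have := cardC1 k; rewrite card_ord => ->.
  by rewrite -subn1 natrB// ltnW.
have := softmax_error c beta phi k x.
case: D HD => [d| |] HD err.
- rewrite -EFinM lee_fin (le_trans err)// [(_ - 1) * _]mulrC -mulrA.
  (* The factor K - 1 counts the losers, each contributing at most exp(-beta d). *)
  rewrite ler_wpM2l// -cardK mulr_natl -sumr_const.
  apply: ler_sum => j jk; rewrite ler_expR lerN2 ler_pM2l//.
  by have := HD j jk; rewrite lee_fin.
(* As K >= 2 there is a loser, and its finite difference bounds [D] from above, so [D] cannot be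
   +oo. *)
- have [j jk] : exists j, j != k.
    apply/existsP; rewrite -[X in is_true X]negbK negb_exists.
    apply/negP => /forallP nk; move: K10; rewrite -cardK.
    by rewrite eq_card0 ?ltxx// => j; rewrite inE; exact/negbTE/nk.
  by have := HD j jk; rewrite leye_eq.
- rewrite gt0_muleNy ?lte_fin//=.
  have [J0'|J0'] := eqVneq (max_jump c) 0.
    by move: err; rewrite J0' mulr0 mul0e mul0r lee_fin.
  by rewrite gt0_muley ?leey// lte_fin mulr_gt0// lt0r J0'.
Qed.

Lemma delta_gap_le phi (winner : R * R -> 'I_K) delta x j :
  far_from delta (tie_set phi) x -> j != winner x ->
  (delta_gap phi winner delta <= (phi (winner x) x - phi j x)%:E)%E.
Proof.
move=> far jk; apply: (@le_trans _ _ (winner_gap phi winner x)).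
  by apply: ereal_inf_lbound; exists x.
rewrite EFinB leeB//.
exact: (le_bigmax_cond _ (fun j => (phi j x)%:E)).
Qed.

Lemma marker_error_ge phi psi (k : 'I_K) x :
  continuous (phi k) -> continuous (psi k) ->
  (`|(phi k x - psi k x)%:E| <= marker_error phi psi)%E.
Proof.
move=> phic psic; rewrite /marker_error.
apply: (@le_trans _ _ 'N[area R]_+oo[EFin \o (phi k - psi k)%R]%E).
  apply: (@le_Lnormy_continuous R (phi k - psi k)) => y.
  by apply: cvgB; [exact: phic|exact: psic].
exact: (le_bigmax _ (fun k => 'N[area R]_+oo[EFin \o (phi k - psi k)%R]%E)).
Qed.

End Phases.

Theorem theorem6p3 (R : realType) (K : nat) (hK : (2 <= K)%N)
  (alpha : R) (halpha : 0 < alpha < 1)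
  (c : 'I_K -> R) (beta : R) (hbeta : 0 < beta)
  (phi_in : 'I_K -> R * R -> R)
  (hphi : forall k, torus_C1alpha alpha (phi_in k))
  (hcover : (area R).-negligible (~` \bigcup_k phase phi_in k))
  (u : R -> R * R -> R * R) (X : R -> R * R -> R * R)
  (w := fun t => sharp_vorticity c (fun k => X t @` phase phi_in k))
  (hw : yudovich_solution (sharp_vorticity c (phase phi_in)) w u X)
  (wb : R -> R * R -> R)
  (ub : R -> R * R -> R * R) (Xb : R -> R * R -> R * R)
  (hwb : yudovich_solution (softmax_vorticity c beta phi_in) wb ub Xb)
  (hwb_cont : forall s, 0 <= s -> continuous (wb s))
  (t : R) (ht : 0 <= t) (delta : R) (hdelta : 0 < delta)
  (phi := fun k => transport X (phi_in k) t)
  (phib := fun k => transport Xb (phi_in k) t)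
  (winner : R * R -> 'I_K) (hwinner : is_winner phi winner) :
  (sup_on (far_from delta (tie_set phi)) (fun x => (wb t x - w t x)%R) <=
   ((K%:R - 1) * max_jump c)%:E *
   expeR (- (beta%:E * (delta_gap phi winner delta -
                        2%:E * marker_error phib phi))))%E.
Proof.
have phi_in_cont k : continuous (phi_in k).
  by move=> x; apply: differentiable_continuous; have [[_ + _ _] _] := hphi k.
have hX := flow_homeo (yudovich_flow hw) ht.
have hXb := flow_homeo (yudovich_flow hwb) ht.
have phi_cont k : continuous (phi k) by exact: transport_continuous.
have phib_cont k : continuous (phib k) by exact: transport_continuous.
(* Softmax acts pointwise on the markers, so transporting the initial vorticity is by definition the
   softmax of the transported markers. Continuity upgrades the almost everywhere equality. *)
have wbE x : wb t x = softmax_vorticity c beta phib x.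
  apply: (@ae_eq_continuous _ (wb t) (softmax_vorticity c beta phib)) => //.
  - exact: hwb_cont.
  - exact: softmax_continuous.
  - exact: (yudovich_transport hwb).
have wE x : far_from delta (tie_set phi) x -> w t x = c (winner x).
  move=> /(far_phase hdelta hwinner) xk; rewrite /w.
  under [X in sharp_vorticity _ X]eq_fun do rewrite image_phase//.
  exact: sharp_vorticityE.
(* The adjoined value 0 only asks for a nonnegative right-hand side; [winner 0] merely supplies an
   index. *)
apply: ge_ereal_sup => _ [[x far <-]|->]; last first.
  rewrite mule_ge0 ?expeR_ge0// lee_fin mulr_ge0//.
    by rewrite subr_ge0 ler1n ltnW.
  by apply: le_trans (max_jump_ge c (winner 0) (winner 0)).
(* The index is the winner for [phi] whereas the weights come from [phib]; the softmax bound holds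
   at any index. *)
rewrite wbE wE//; apply: softmax_error_ereal => // j jk.
have gap := delta_gap_le far jk.
have err k := @marker_error_ge _ _ phib phi k x (phib_cont k) (phi_cont k).
(* The difference of two markers changes by at most one error for the winner and one for the loser,
   hence the 2 in the exponent. *)
have err2 := leeD (err (winner x)) (err j).
apply: le_trans (leeB gap _) _.
  by rewrite mule_natl; exact: err2.
rewrite /= -EFinB lee_fin.
have := ler_norm (phi (winner x) x - phib (winner x) x).
rewrite distrC; have := ler_norm (phib j x - phi j x); lra.
Qed.
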